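(* ($\beta$-Korkine identity) Let $a<b$ and let $f,g:[a,b]\to\mathbb{R}$ be two absolutely $\beta$-integrable functions on $[a,b]$. Then $$T_\beta(f,g)=\frac{1}{2(b-a)^2}\int_a^b\int_a^b\big(f(x)-f(y)\big)\big(g(x)-g(y)\big)\,d_\beta x\,d_\beta y .$$
   Context: Setting: $I\subseteq\mathbb{R}$ is an interval, $a,b\in I$, and $\beta:I\to I$ is a strictly increasing continuous function with exactly one fixed point $s_0\in I$, satisfying $(t-s_0)(\beta(t)-t)\le 0$ for all $t\in I$, with equality only if $t=s_0$. Write $\beta^0(t)=t$ and $\beta^k$ for the $k$-fold composition of $\beta$ with itself. The $\beta$-integral is $\int_a^b h\,d_\beta:=\int_{s_0}^b h\,d_\beta-\int_{s_0}^a h\,d_\beta$, where $\int_{s_0}^x h\,d_\beta:=\sum_{k=0}^{\infty}\big(\beta^k(x)-\beta^{k+1}(x)\big)h\big(\beta^k(x)\big)$; also written $\int_a^b h(x)\,d_\beta x$. The function $h$ is $\beta$-integrable on $[a,b]$ if these series converge for $x=a$ and $x=b$, and absolutely $\beta$-integrable on $[a,b]$ if $|h|$ is $\beta$-integrable on $[a,b]$. The double integral is the iterated $\beta$-integral. For two absolutely $\beta$-integrable functions $f,g:[a,b]\to\mathbb{R}$ on $[a,b]$, the Chebyshev functional is $$T_\beta(f,g):=\frac{1}{b-a}\int_a^b f(x)g(x)\,d_\beta x-\left(\frac{1}{b-a}\int_a^b f(x)\,d_\beta x\right)\left(\frac{1}{b-a}\int_a^b g(x)\,d_\beta x\right).$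$
   Formalization: The product fg is additionally assumed β-integrable on [a,b]; absolute β-integrability of f and g does not imply this (β(t)=t/2, f=g=t^(-1/2) on (0,1], f(0)=0, a=0, b=1), and without it T_β(f,g) is undefined. *)

(* Defs.v *)
From mathcomp Require Import all_boot all_order all_algebra.
From mathcomp Require Import all_classical all_reals all_analysis.

Set Implicit Arguments.
Unset Strict Implicit.
Unset Printing Implicit Defensive.

Import Order.TTheory GRing.Theory Num.Theory.
Import numFieldNormedType.Exports.

Local Open Scope classical_set_scope.
Local Open Scope ring_scope.

(* A map I -> I is represented by a function R -> R that preserves I; its
   values outside I play no role. *)
Record beta_map (R : realType) (I : interval R) (beta : R -> R) (s0 : R) :
    Prop := BetaMap {
  beta_map_stable : forall t, t \in I -> beta t \in I ;
  beta_map_incr : {in I &, {homo beta : s t / s < t}} ;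
  beta_map_cont : {within [set` I], continuous beta} ;
  beta_map_fix_in : s0 \in I ;
  beta_map_fix : beta s0 = s0 ;
  beta_map_fix_uniq : forall t, t \in I -> beta t = t -> t = s0 ;
  beta_map_sign : forall t, t \in I -> (t - s0) * (beta t - t) <= 0 ;
  beta_map_sign_eq :
    forall t, t \in I -> (t - s0) * (beta t - t) = 0 -> t = s0
}.

Section BetaIntegral.
Variables (R : realType) (beta : R -> R).
Implicit Types (f g h : R -> R) (a b x : R).

Definition beta_term h x : R^nat :=
  fun k => (iter k beta x - iter k.+1 beta x) * h (iter k beta x).

(* The integral of h from s0 to x. The fixed point s0 does not occur in the
   defining series. limn is a total operator, meaningful only when the series
   converges. *)
Definition beta_int0 h x : R := limn (series (beta_term h x)).

Definition beta_int a b h : R := beta_int0 h b - beta_int0 h a.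

Definition beta_integrable a b h : Prop :=
  cvgn (series (beta_term h a)) /\ cvgn (series (beta_term h b)).

Definition abs_beta_integrable a b h : Prop :=
  beta_integrable a b (fun x => `|h x|).

Definition beta_chebyshev a b f g : R :=
  (b - a)^-1 * beta_int a b (fun x => f x * g x)
  - ((b - a)^-1 * beta_int a b f) * ((b - a)^-1 * beta_int a b g).

End BetaIntegral.

(* Main.v *)
(* The beta-integral is linear, and since the orbits of beta converge
   monotonically to s0, the series of a constant c telescopes to (x - s0) * c,
   while absolute integrability implies integrability. Expanding the product
   and integrating in x, then in y, gives
   2 (b - a) \int f g - 2 (\int f) (\int g). *)
Require Import Defs.
From mathcomp Require Import all_boot all_order all_algebra.
From mathcomp Require Import all_classical all_reals all_analysis.
From mathcomp Require Import ring.

Set Implicit Arguments.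
Unset Strict Implicit.
Unset Printing Implicit Defensive.

Import Order.TTheory GRing.Theory Num.Theory.
Import numFieldNormedType.Exports.

Local Open Scope ring_scope.

Lemma segment_itv (R : realType) (I : interval R) (x y z : R) :
  x \in I -> y \in I -> x <= z -> z <= y -> z \in I.
Proof.
by move=> xI yI xz zy; apply: (@interval_is_interval R I x y) => //; rewrite xz.
Qed.

Section BetaOrbit.
Local Open Scope classical_set_scope.
Local Open Scope ring_scope.
Variables (R : realType) (I : interval R) (beta : R -> R) (s0 : R).
Hypothesis hbeta : beta_map I beta s0.

Lemma iter_beta_in x k : x \in I -> iter k beta x \in I.
Proof. by move=> xI; elim: k => //= k; exact: (beta_map_stable hbeta). Qed.

Lemma le_beta x y : x \in I -> y \in I -> x <= y -> beta x <= beta y.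
Proof.
move=> xI yI; rewrite le_eqVlt => /predU1P[->//|xy].
by apply/ltW/(beta_map_incr hbeta).
Qed.

Lemma beta_le x : x \in I -> s0 <= x -> beta x <= x.
Proof.
move=> xI; rewrite le_eqVlt => /predU1P[<-|s0x];
  first by rewrite (beta_map_fix hbeta).
by have := beta_map_sign hbeta xI; rewrite pmulr_rle0 ?subr_gt0// subr_le0.
Qed.

Lemma beta_ge x : x \in I -> x <= s0 -> x <= beta x.
Proof.
move=> xI; rewrite le_eqVlt => /predU1P[->|xs0];
  first by rewrite (beta_map_fix hbeta).
by have := beta_map_sign hbeta xI; rewrite nmulr_rle0 ?subr_lt0// subr_ge0.
Qed.

(** An increasing map that fixes [s0] cannot carry a point across [s0], so each orbit stays on its
    side. *)
Lemma iter_beta_ge x k : x \in I -> s0 <= x -> s0 <= iter k beta x.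
Proof.
move=> xI s0x; elim: k => //= k IH.
by rewrite -[leLHS](beta_map_fix hbeta) le_beta ?iter_beta_in//;
  exact: (beta_map_fix_in hbeta).
Qed.

Lemma iter_beta_le x k : x \in I -> x <= s0 -> iter k beta x <= s0.
Proof.
move=> xI xs0; elim: k => //= k IH.
by rewrite -[leRHS](beta_map_fix hbeta) le_beta ?iter_beta_in//;
  exact: (beta_map_fix_in hbeta).
Qed.

(** Continuity at [l] sends the shifted orbit to [beta l], but a shifted orbit keeps its limit [l];
    hence [l] is fixed by [beta]. *)
Lemma iter_beta_lim_fixed x l : x \in I -> l \in I ->
  (fun k => iter k beta x) @ \oo --> l -> l = s0.
Proof.
move=> xI lI ul; apply: (beta_map_fix_uniq hbeta) => //.
have /subspace_continuousP/(_ l lI) cl := beta_map_cont hbeta.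
(* Continuity is only relative to [I], so the orbit must converge along the neighbourhoods of [l]
   traced on [I]; it never leaves [I]. *)
have uw : (fun k => iter k beta x) @ \oo --> within [set` I] (nbhs l).
  by move=> P /ul[N _ NP]; exists N => // k /NP; apply; exact: iter_beta_in.
have := cvg_comp _ _ uw cl.
rewrite -(cvg_shiftS (fun k => iter k beta x)) in ul.
by move=> bl; exact: (cvg_unique _ bl ul).
Qed.

(** On either side of [s0] the orbit is monotone and bounded by [s0], so it converges. Its limit
    lies between [x] and [s0], hence in [I] even if [I] is not closed. *)
Lemma cvg_iter_beta x : x \in I -> (fun k => iter k beta x) @ \oo --> s0.
Proof.
move=> xI; have s0I := beta_map_fix_in hbeta.
suff [l lI ul] : exists2 l, l \in I & (fun k => iter k beta x) @ \oo --> l.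
  by rewrite -(iter_beta_lim_fixed xI lI ul).
have [s0x|/ltW xs0] := leP s0 x.
- have u_dec : nonincreasing_seq (fun k => iter k beta x).
    by apply/nonincreasing_seqP => k; rewrite beta_le ?iter_beta_in ?iter_beta_ge.
  have cu : cvgn (fun k => iter k beta x).
    by apply: nonincreasing_is_cvgn => //; exists s0 => _ [k _ <-];
      exact: iter_beta_ge.
  exists (limn (fun k => iter k beta x)) => //.
  apply: (segment_itv s0I xI).
  + by apply: limr_ge => //; near=> k; exact: iter_beta_ge.
  + exact: (nonincreasing_cvgn_ge u_dec cu 0%N).
- have u_inc : nondecreasing_seq (fun k => iter k beta x).
    by apply/nondecreasing_seqP => k; rewrite beta_ge ?iter_beta_in ?iter_beta_le.
  have cu : cvgn (fun k => iter k beta x).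
    by apply: nondecreasing_is_cvgn => //; exists s0 => _ [k _ <-];
      exact: iter_beta_le.
  exists (limn (fun k => iter k beta x)) => //.
  apply: (segment_itv xI s0I).
  + exact: (nondecreasing_cvgn_le u_inc cu 0%N).
  + by apply: limr_le => //; near=> k; exact: iter_beta_le.
Unshelve. all: by end_near. Qed.

Lemma cvg_series_beta_term_cst x c : x \in I ->
  series (beta_term beta (fun=> c) x) @ \oo --> (x - s0) * c.
Proof.
(* Closed form of the telescoping partial sums; only the [n]-th iterate still moves, and it tends to
   [s0]. *)
move=> xI; suff -> : series (beta_term beta (fun=> c) x) =
    (fun n => (x - iter n beta x) * c).
  by apply: cvgMr_tmp; apply: cvgB; [exact: cvg_cst|exact: cvg_iter_beta].
apply/funext => n; elim: n => [|n IH].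
  by rewrite seriesEnat/= big_geq// subrr mul0r.
by rewrite seriesSr IH /beta_term -mulrDl addrA subrK.
Qed.

(* The increments of an orbit all have the same sign, so up to a global sign
   the series of |h| is the series of absolute values of the terms of h. *)
Lemma abs_cvg_series_beta_term x h : x \in I ->
  cvgn (series (beta_term beta (fun t => `|h t|) x)) ->
  cvgn (series (beta_term beta h x)).
Proof.
move=> xI ch; apply: normed_cvg; have [s0x|/ltW xs0] := leP s0 x.
- suff -> : [normed series (beta_term beta h x)] =
    series (beta_term beta (fun t => `|h t|) x) by [].
  congr series; apply/funext => k; rewrite /= normrM ger0_norm// subr_ge0.
  by rewrite beta_le ?iter_beta_in ?iter_beta_ge.
- suff -> : [normed series (beta_term beta h x)] =
    - series (beta_term beta (fun t => `|h t|) x) by exact: is_cvgN.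
  rewrite -seriesN; congr series; apply/funext => k.
  rewrite /= normrM ler0_norm ?mulNr// subr_le0.
  by rewrite beta_ge ?iter_beta_in ?iter_beta_le.
Qed.

End BetaOrbit.

Section HasBetaInt.
Local Open Scope classical_set_scope.
Local Open Scope ring_scope.
Variables (R : realType) (beta : R -> R) (a b : R).

(** Since [limn] is total, the value of [beta_int] is informative only together with convergence;
    bundling the two lets the linearity rules carry integrability along. *)
Definition has_beta_int (h : R -> R) (v : R) : Prop :=
  beta_integrable beta a b h /\ beta_int beta a b h = v.

Lemma beta_integrable_has_int h :
  beta_integrable beta a b h -> has_beta_int h (beta_int beta a b h).
Proof. by []. Qed.

Lemma has_beta_intP h v : has_beta_int h v <->
  exists va vb, [/\ series (beta_term beta h a) @ \oo --> va,
    series (beta_term beta h b) @ \oo --> vb & v = vb - va].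
Proof.
split=> [[[ca cb] <-]|[va [vb [ca cb ->]]]].
  by exists (beta_int0 beta h a), (beta_int0 beta h b).
split; first by split; [apply: cvgP ca|apply: cvgP cb].
by rewrite /beta_int /beta_int0 (cvg_lim _ ca)// (cvg_lim _ cb).
Qed.

Lemma has_beta_intD h1 h2 v1 v2 : has_beta_int h1 v1 -> has_beta_int h2 v2 ->
  has_beta_int (fun x => h1 x + h2 x) (v1 + v2).
Proof.
have sD x : series (beta_term beta (fun x => h1 x + h2 x) x) =
    series (beta_term beta h1 x) + series (beta_term beta h2 x).
  by rewrite -seriesD; congr series; apply/funext => k; rewrite /beta_term mulrDr.
move=> /has_beta_intP[a1 [b1 [ca1 cb1 ->]]] /has_beta_intP[a2 [b2 [ca2 cb2 ->]]].
apply/has_beta_intP; exists (a1 + a2), (b1 + b2).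
by rewrite !sD; split; [exact: cvgD|exact: cvgD|rewrite opprD addrACA].
Qed.

Lemma has_beta_intZ c h v : has_beta_int h v ->
  has_beta_int (fun x => c * h x) (c * v).
Proof.
have sZ x : series (beta_term beta (fun x => c * h x) x) =
    c *: series (beta_term beta h x).
  by rewrite -seriesZ; congr series; apply/funext => k; rewrite /beta_term mulrCA.
move=> /has_beta_intP[va [vb [ca cb ->]]].
apply/has_beta_intP; exists (c * va), (c * vb).
by rewrite !sZ; split; [exact: cvgZl_tmp|exact: cvgZl_tmp|rewrite mulrBr].
Qed.

(** The series at [b] and at [a] sum to [(b - s0) * c] and [(a - s0) * c], so [s0] cancels in the
    difference. *)
Lemma has_beta_int_cst I s0 c : beta_map I beta s0 -> a \in I -> b \in I ->
  has_beta_int (fun=> c) ((b - a) * c).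
Proof.
move=> hbeta aI bI; apply/has_beta_intP.
exists ((a - s0) * c), ((b - s0) * c).
split; [exact: (cvg_series_beta_term_cst hbeta)|
        exact: (cvg_series_beta_term_cst hbeta)|].
by rewrite -mulrBl; congr (_ * _); rewrite opprB addrA subrK.
Qed.

Lemma abs_beta_integrable_integrable I s0 h :
  beta_map I beta s0 -> a \in I -> b \in I ->
  abs_beta_integrable beta a b h -> beta_integrable beta a b h.
Proof.
move=> hbeta aI bI [ca cb].
by split; [exact: (abs_cvg_series_beta_term hbeta aI)|
           exact: (abs_cvg_series_beta_term hbeta bI)].
Qed.

End HasBetaInt.

(* The hypothesis on f * g is what makes the first
   integral in the Chebyshev functional exist. The first two conclusions say
   that the iterated integral on the right-hand side exists. *)
Theorem lemma3p4 (R : realType) (I : interval R) (beta : R -> R) (s0 a b : R)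
    (f g : R -> R)
    (hbeta : beta_map I beta s0) (ha : a \in I) (hb : b \in I) (hab : a < b)
    (hf : abs_beta_integrable beta a b f)
    (hg : abs_beta_integrable beta a b g)
    (hfg : beta_integrable beta a b (fun x => f x * g x)) :
  [/\ forall y, y \in I ->
        beta_integrable beta a b (fun x => (f x - f y) * (g x - g y)),
      beta_integrable beta a b (fun y =>
        beta_int beta a b (fun x => (f x - f y) * (g x - g y)))
    & beta_chebyshev beta a b f g =
      (2 * (b - a) ^+ 2)^-1 *
        beta_int beta a b (fun y =>
          beta_int beta a b (fun x => (f x - f y) * (g x - g y)))].
Proof.
have /beta_integrable_has_int Hf := abs_beta_integrable_integrable hbeta ha hb hf.
have /beta_integrable_has_int Hg := abs_beta_integrable_integrable hbeta ha hb hg.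
have /beta_integrable_has_int Hfg := hfg.
have Hcst c := has_beta_int_cst c hbeta ha hb.
set F := beta_int beta a b f in Hf *; set G := beta_int beta a b g in Hg *.
set P := beta_int beta a b (fun x => f x * g x) in Hfg *.
(* For fixed [y], [f y] and [g y] are constants: the integrand is a linear combination of [f * g],
   [f], [g] and a constant. *)
have inner y : has_beta_int beta a b (fun x => (f x - f y) * (g x - g y))
    (P + (- g y * F + (- f y * G + (b - a) * (f y * g y)))).
  rewrite (_ : (fun x => _) =
    (fun x => f x * g x + (- g y * f x + (- f y * g x + f y * g y)))).
    apply: has_beta_intD => //; apply: has_beta_intD; first exact: has_beta_intZ.
    by apply: has_beta_intD; [exact: has_beta_intZ|exact: Hcst].
  by apply/funext => x; ring.
(* Now [P], [F] and [G] are the constants: [P] integrates to [(b - a) * P], each cross term gives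
   [- F * G], and the product term gives [(b - a) * P] again. *)
have outer : has_beta_int beta a b (fun y =>
      beta_int beta a b (fun x => (f x - f y) * (g x - g y)))
    ((b - a) * P + (- F * G + (- G * F + (b - a) * P))).
  rewrite (_ : (fun y => _) =
    (fun y => P + (- F * g y + (- G * f y + (b - a) * (f y * g y))))).
    apply: has_beta_intD; first exact: Hcst.
    apply: has_beta_intD; first exact: has_beta_intZ.
    by apply: has_beta_intD; exact: has_beta_intZ.
  by apply/funext => y; rewrite (inner y).2; ring.
split; [by move=> y _; exact: (inner y).1|exact: outer.1|].
(* It remains to divide [2 * ((b - a) * P - F * G)] by [2 * (b - a) ^+ 2], where [b - a] is nonzero
   because [a < b]. *)
rewrite outer.2 /beta_chebyshev -/F -/G -/P.
by field; rewrite subr_eq0 gt_eqF.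
Qed.
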